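(* Let $\mathbf{A}$ be an implicator groupoid. Then the following identities hold in $\mathbf{A^{mj}}$: (a) $(x \land y) \land (x \lor y) \approx x \land y$; (b) $(x \lor y) \lor (x \land y) \approx x \lor y$.
   Context: An implicator groupoid is an algebra $\mathbf A = \langle A, \to, 0 \rangle$, with $\to$ binary and $0$ a constant, which, writing $x' := x \to 0$, satisfies the identities (I) $(x \to y) \to z \approx [(z' \to x) \to (y \to z)']'$ and (I$_0$) $0'' \approx 0$. Put $x \land y := (x \to y')'$ and $x \lor y := (x' \land y')'$, and let $\mathbf{A^{mj}} := \langle A, \land, \lor, 0 \rangle$. *)

(* Defs.v *)
Set Implicit Arguments.
Unset Strict Implicit.

Declare Scope implicator_scope.
Delimit Scope implicator_scope with implicator.

Record groupoid0 : Type := Groupoid0 {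
  carrier :> Type;
  imp : carrier -> carrier -> carrier;
  zero : carrier
}.

Arguments zero {g}.

Notation "x ~> y" := (imp x y) (at level 55, right associativity)
  : implicator_scope.

Definition neg (A : groupoid0) (x : A) : A := imp x zero.

Notation "x ^'" := (neg x) (at level 2, left associativity, format "x ^'")
  : implicator_scope.

Local Open Scope implicator_scope.

Record is_implicator_groupoid (A : groupoid0) : Prop := {
  implicator_I : forall x y z : A,
    (x ~> y) ~> z = ((z^' ~> x) ~> (y ~> z)^')^';
  implicator_I0 : (zero : A)^'^' = zero
}.

Record mj_algebra : Type := MJAlgebra {
  mj_carrier :> Type;
  mj_meet : mj_carrier -> mj_carrier -> mj_carrier;
  mj_join : mj_carrier -> mj_carrier -> mj_carrier;
  mj_zero : mj_carrier
}.

Notation "x ∧ y" := (mj_meet x y) (at level 40, left associativity)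
  : implicator_scope.
Notation "x ∨ y" := (mj_join x y) (at level 50, left associativity)
  : implicator_scope.

Definition meet (A : groupoid0) (x y : A) : A := (x ~> y^')^'.
Definition join (A : groupoid0) (x y : A) : A := (meet x^' y^')^'.

Definition mj (A : groupoid0) : mj_algebra :=
  MJAlgebra (@meet A) (@join A) (@zero A).

(* Main.v *)
From Stdlib Require Import Setoid Morphisms.
Require Import Defs.

(** Write [x ≡ y] when [x] and [y] have the same double negation.

    In an implicator groupoid, replacing an argument of an implication by its
    double negation cannot be detected once that implication is itself put to
    the left of another one ([dneg_imp_imp], [imp_dneg_imp]). Hence [≡] is a
    congruence: up to [≡] the axiom (I) still holds, and moreover negation is
    an involution and [1 := 0'] is a left unit ([one_imp]).

    Unfolding meet and join, both identities become, up to [≡], instances of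
    the single identity [neg_imp_neg_imp_neg]:

      (x ~> y)' ~> (x' ~> y')' ≡ x ~> y,

    with [y] replaced by [y'] for the first and [x] by [x'] for the second.
    With [u := x ~> y] and [v := x' ~> y'], contraposition ([contrapos]) turns
    [u' ~> v'] into [((v ~> u) ~> (0 ~> v')')'], and [u ~> (0 ~> u)' ≡ u'], so
    it is enough to show

      v ~> u ≡ u    and    0 ~> v' ≡ 0 ~> u.

    Since [x ≡ (x ~> 0) ~> 0] and [y'] is [y ~> 0], the first of these is the
    case [z := 0] of an exchange law ([imp_imp_exchange]) for [x'], [y], [z],
    which comes from the contraction law
    [x ~> (y ~> (x ~> z)) ≡ y ~> (x ~> z)] ([imp_imp_imp_contract]). The second
    is [zero_imp_neg_neg_imp]. Both rest on how [0 ~> _] moves through implications: it can be absorbed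
    ([zero_imp_absorb], [imp_zero_imp_imp]), it can be traded for [z ~> _] when
    [z] is the final conclusion ([imp_zero_imp_imp_any]), and it commutes with
    left implication ([imp_zero_imp_swap]).

    An equivalence [s ≡ t] only gives equality of double negations. This is
    enough because the meets are negations of implications, and on those three
    negations amount to one ([tneg_of_imp]); the joins are double negations
    already. *)

Local Open Scope implicator_scope.

Section ImplicatorGroupoid.
Context (A : groupoid0) (hA : is_implicator_groupoid A).
Implicit Types x y z u v w : A.
Local Notation "0" := (@zero A).
Local Notation "1" := (neg (@zero A)).

(** * Double negation inside implications *)

Lemma dneg_zero : 0^'^' = 0.
Proof. exact (implicator_I0 hA). Qed.

Lemma impI x y z : (x ~> y) ~> z = ((z^' ~> x) ~> (y ~> z)^')^'.
Proof. exact (implicator_I hA x y z). Qed.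

Lemma negI x y : (x ~> y)^' = ((1 ~> x) ~> y^'^')^'.
Proof. exact (impI x y 0). Qed.

Lemma neg_impI x y : x^' ~> y = ((y^' ~> x) ~> (0 ~> y)^')^'.
Proof. exact (impI x 0 y). Qed.

(** This is (I) for [(x ~> 0) ~> 0], because [(0 ~> 0)' = 0]. *)
Lemma dneg_one_imp x : (1 ~> x)^'^' = x^'^'.
Proof.
  change (((1 ~> x)^')^' = (x ~> 0) ~> 0).
  rewrite (impI x 0 0). change (0 ~> 0) with 1. now rewrite dneg_zero.
Qed.

Lemma neg_imp_one_imp x y : (x ~> (1 ~> y))^' = (x ~> y)^'.
Proof. now rewrite negI, dneg_one_imp, <- negI. Qed.

Lemma neg_zero_imp_dneg x : (0 ~> x^'^')^' = (0 ~> x)^'.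
Proof.
  rewrite (negI 0 x). change (1 ~> 0) with (0^'^'). now rewrite dneg_zero.
Qed.

Lemma neg_zero_imp_neg_one_imp x : (0 ~> (1 ~> x)^')^' = (0 ~> x^')^'.
Proof.
  now rewrite <- neg_zero_imp_dneg, dneg_one_imp, neg_zero_imp_dneg.
Qed.

Lemma neg_imp_neg_one_imp x y : x^' ~> (1 ~> y)^' = x^' ~> y^'.
Proof.
  now rewrite (neg_impI x (_^')), dneg_one_imp, neg_zero_imp_neg_one_imp, <- neg_impI.
Qed.

Lemma neg_one_imp_imp_imp x y z : ((1 ~> x)^' ~> y) ~> z = (x^' ~> y) ~> z.
Proof. now rewrite (impI _ _ z), neg_imp_neg_one_imp, <- (impI _ _ z). Qed.

(** Expanding by (I) puts the right argument [1 ~> z] under negations only,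
    where the factor [1] is known to vanish; folding by (I) gives the claim. The
    same expand-simplify-fold scheme removes [1] from the other two arguments. *)
Lemma imp_imp_one_imp x y z : (x ~> y) ~> (1 ~> z) = (x ~> y) ~> z.
Proof. now rewrite (impI _ _ (_ ~> _)), neg_one_imp_imp_imp, neg_imp_one_imp, <- (impI _ _ z). Qed.

Lemma one_imp_imp_imp x y z : ((1 ~> x) ~> y) ~> z = (x ~> y) ~> z.
Proof.
  rewrite (impI _ _ z). change (z^') with (z ~> 0) at 1.
  now rewrite imp_imp_one_imp, <- (impI _ _ z).
Qed.

(** The expansion of [(x ~> y)'] by (I) is [((1 ~> x) ~> y'')'], where the factor
    [1] can be dropped. *)
Lemma neg_imp_dneg x y : (x ~> y^'^')^' = (x ~> y)^'.
Proof.
  rewrite (negI x y). symmetry. exact (one_imp_imp_imp x _ 0).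
Qed.

Lemma imp_one_imp_imp x y z : (x ~> (1 ~> y)) ~> z = (x ~> y) ~> z.
Proof.
  rewrite (impI x _ z).
  rewrite (one_imp_imp_imp y z 0 : ((1 ~> y) ~> z)^' = (y ~> z)^').
  now rewrite <- impI.
Qed.

Lemma tneg_imp x y : x^'^'^' ~> y = x^' ~> y.
Proof.
  change ((x^'^' ~> 0) ~> y = x^' ~> y).
  rewrite <- one_imp_imp_imp. change ((1 ~> x^'^')^' ~> y = x^' ~> y).
  rewrite neg_imp_dneg. exact (one_imp_imp_imp x 0 y).
Qed.

Lemma imp_imp_dneg x y z : (x ~> y) ~> z^'^' = (x ~> y) ~> z.
Proof. now rewrite (impI _ _ (_^'^')), tneg_imp, neg_imp_dneg, <- (impI _ _ z). Qed.

(** Once [1 ~> y''] stands in place of [y''], it is an implication with the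
    implication [1 = 0 ~> 0] on its left, so that [imp_imp_dneg] applies. *)
Lemma imp_dneg_imp x y z : (x ~> y^'^') ~> z = (x ~> y) ~> z.
Proof.
  rewrite <- imp_one_imp_imp.
  change 1 with (0 ~> 0). rewrite imp_imp_dneg. apply imp_one_imp_imp.
Qed.

Lemma dneg_imp_imp x y z : (x^'^' ~> y) ~> z = (x ~> y) ~> z.
Proof.
  rewrite <- one_imp_imp_imp.
  change 1 with (0 ~> 0). rewrite imp_imp_dneg. apply one_imp_imp_imp.
Qed.

(** * Equality up to double negation *)

Definition dneg_eq x y : Prop := x^'^' = y^'^'.
Local Notation "x ≡ y" := (dneg_eq x y) (at level 70).

#[local] Instance dneg_eq_equivalence : Equivalence dneg_eq.
Proof.
  unfold dneg_eq; split; [intros x | intros x y | intros x y z]; congruence.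
Qed.

(** [(x ~> y)''] is [((x ~> y) ~> 0) ~> 0], in which [x] and [y] may be
    replaced by their double negations. *)
#[local] Instance imp_dneg_eq_proper :
  Proper (dneg_eq ==> dneg_eq ==> dneg_eq) (@imp A).
Proof.
  intros x x1 hx y y1 hy.
  change (((x ~> y) ~> 0) ~> 0 = ((x1 ~> y1) ~> 0) ~> 0).
  rewrite <- (dneg_imp_imp x y), <- (imp_dneg_imp _ y).
  rewrite hx, hy.
  now rewrite imp_dneg_imp, dneg_imp_imp.
Qed.

#[local] Instance neg_dneg_eq_proper : Proper (dneg_eq ==> dneg_eq) (@neg A).
Proof. intros x y h. unfold neg. now rewrite h. Qed.

Lemma dneg_equiv x : x^'^' ≡ x.
Proof. apply tneg_imp. Qed.

Lemma neg_inj x y : x^' ≡ y^' -> x ≡ y.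
Proof. intros h. now rewrite <- (dneg_equiv x), h, dneg_equiv. Qed.

Lemma neg_imp_imp_expand x y z : ((x ~> y) ~> z)^' ≡ (z^' ~> x) ~> (y ~> z)^'.
Proof. now rewrite (impI x y z), dneg_equiv. Qed.

(** The case of (I) in which the first argument is [0], since then [y' ~> 0] is
    [y'']. It is the main way to create or remove a leading [0]. *)
Lemma neg_zero_imp_imp x y : ((0 ~> x) ~> y)^' ≡ y ~> (x ~> y)^'.
Proof. rewrite neg_imp_imp_expand. change (y^' ~> 0) with (y^'^'). now rewrite dneg_equiv. Qed.

(** (I) applied to [x'' ~> y]: implication is not plainly contrapositive, and
    [0 ~> y] measures the defect. *)
Lemma contrapos x y : x ~> y ≡ ((y^' ~> x^') ~> (0 ~> y)^')^'.
Proof. rewrite <- (impI x^' 0 y). change (x^' ~> 0) with (x^'^'). now rewrite dneg_equiv. Qed.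

(** * Absorption laws *)

Lemma one_imp x : 1 ~> x ≡ x.
Proof. now rewrite <- (dneg_equiv (1 ~> x)), dneg_one_imp, dneg_equiv. Qed.

Lemma neg_one : 1^' ≡ 0.
Proof. apply dneg_equiv. Qed.

Lemma imp_neg_zero_imp x : x ~> (0 ~> x)^' ≡ x^'.
Proof. rewrite <- neg_zero_imp_imp. change (0 ~> 0) with 1. now rewrite one_imp. Qed.

Lemma zero_imp_imp_one x : (0 ~> x) ~> 1 ≡ x ~> 1.
Proof.
  apply neg_inj. now rewrite neg_zero_imp_imp, one_imp.
Qed.

Lemma zero_imp_one : 0 ~> 1 ≡ 1.
Proof.
  rewrite <- zero_imp_imp_one. change (0 ~> 0) with 1. apply one_imp.
Qed.

Lemma imp_neg_self x : x ~> x^' ≡ x^'.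
Proof.
  rewrite <- (one_imp x) at 2. now rewrite <- neg_zero_imp_imp, zero_imp_one, one_imp.
Qed.

Lemma neg_imp_self x : x^' ~> x ≡ x.
Proof. rewrite <- (dneg_equiv x) at 2. now rewrite imp_neg_self, dneg_equiv. Qed.

Lemma imp_imp_self x y : (x ~> y) ~> x ≡ (0 ~> y) ~> x.
Proof. apply neg_inj. now rewrite neg_imp_imp_expand, neg_imp_self, neg_zero_imp_imp. Qed.

Lemma neg_imp_one x : x^' ~> 1 ≡ 0 ~> x.
Proof.
  rewrite neg_impI, zero_imp_one, !neg_one.
  apply dneg_equiv.
Qed.

Lemma imp_one x : x ~> 1 ≡ 0 ~> x^'.
Proof. now rewrite <- neg_imp_one, dneg_equiv. Qed.

Lemma zero_imp_absorb x y : (0 ~> x) ~> (y ~> x)^' ≡ (y ~> x)^'.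
Proof. now rewrite <- neg_imp_one, <- neg_imp_imp_expand, one_imp. Qed.

Lemma neg_imp_zero_imp_imp x y : (x ~> y)^' ~> ((0 ~> x) ~> y) ≡ x ~> y.
Proof.
  rewrite <- (dneg_equiv ((0 ~> x) ~> y)), neg_zero_imp_imp, <- neg_zero_imp_imp.
  now rewrite zero_imp_absorb, dneg_equiv.
Qed.

Lemma imp_one_imp_one x : (x ~> 1) ~> 1 ≡ 0 ~> x.
Proof. now rewrite (imp_one x), zero_imp_imp_one, neg_imp_one. Qed.

Lemma zero_imp_zero_imp x : 0 ~> (0 ~> x) ≡ 0 ~> x.
Proof.
  rewrite <- (imp_one_imp_one (0 ~> x)), <- (neg_imp_one x).
  now rewrite (imp_one_imp_one x^'), zero_imp_imp_one.
Qed.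

(** The left side becomes the expansion by (I) of the right side when
    [(u ~> x) ~> y] is itself expanded. *)
Lemma imp_imp_imp_zero_imp x y z u :
  (((x ~> y) ~> z) ~> ((u ~> x) ~> y))^' ≡ (z ~> (y^' ~> u)) ~> (x ~> y)^'.
Proof.
  now rewrite (impI u x y), (impI z _ (x ~> y)^'), dneg_equiv.
Qed.

Lemma zero_imp_imp_zero_imp x y : (0 ~> x) ~> (0 ~> y) ≡ x ~> (0 ~> y).
Proof.
  apply neg_inj.
  rewrite neg_zero_imp_imp, <- (zero_imp_zero_imp y) at 1.
  now rewrite zero_imp_absorb.
Qed.

(** By (I), [u' ~> v] is [((v' ~> u) ~> (0 ~> v)')'], which the
    hypothesis turns into [(v ~> (0 ~> v)')' ≡ v'']. *)
Lemma imp_of_neg_imp u v : v^' ~> u ≡ v -> u^' ~> v ≡ v.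
Proof.
  intros h.
  now rewrite neg_impI, h, imp_neg_zero_imp, dneg_equiv.
Qed.

Lemma zero_imp_imp_absorb x y : ((0 ~> x) ~> y)^' ~> (x ~> y) ≡ x ~> y.
Proof. apply imp_of_neg_imp, neg_imp_zero_imp_imp. Qed.

Lemma neg_imp_zero_imp x : x^' ~> (0 ~> x) ≡ 0 ~> x.
Proof.
  rewrite <- (zero_imp_imp_absorb 0 x) at 2.
  change (0 ~> 0) with 1. now rewrite one_imp.
Qed.

Lemma zero_imp_imp_imp_self x y : ((0 ~> x) ~> y) ~> x ≡ y ~> x.
Proof.
  apply neg_inj. now rewrite neg_imp_imp_expand, neg_imp_zero_imp, zero_imp_absorb.
Qed.

Lemma imp_zero_imp_imp_imp x y z : (x ~> ((0 ~> y) ~> z)) ~> y ≡ (x ~> z) ~> y.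
Proof. now rewrite (impI x _ y), zero_imp_imp_imp_self, <- impI. Qed.

(** Replacing [(0 ~> x) ~> y] by [(y ~> x) ~> y] exposes the pattern of
    [imp_imp_imp_zero_imp], whose right-hand side is then of the form
    [t ~> t']. *)
Lemma zero_imp_imp_zero_imp_imp x y : ((0 ~> x) ~> y) ~> ((0 ~> y) ~> x) ≡ y ~> x.
Proof.
  apply neg_inj. rewrite <- (imp_imp_self y x).
  rewrite imp_imp_imp_zero_imp. change (x^' ~> 0) with (x^'^').
  now rewrite dneg_equiv, imp_neg_self.
Qed.

(** With [t := (0 ~> x) ~> y], write [x ~> t] as [((0 ~> t) ~> x) ~> t]. In the
    inner part [t] may be replaced by [y], which leaves
    [zero_imp_imp_zero_imp_imp]. *)
Lemma imp_zero_imp_imp x y : x ~> ((0 ~> x) ~> y) ≡ x ~> y.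
Proof.
  rewrite <- (zero_imp_imp_imp_self ((0 ~> x) ~> y) x), imp_zero_imp_imp_imp.
  apply zero_imp_imp_zero_imp_imp.
Qed.

(** * Moving zero through implications *)

Lemma neg_of_imp_one_imp x y : ((x ~> 1) ~> y)^' ≡ (0 ~> x) ~> y^'.
Proof. now rewrite neg_imp_imp_expand, one_imp, imp_imp_self. Qed.

Lemma imp_one_imp_neg x y : (x ~> 1) ~> y^' ≡ ((0 ~> x) ~> y)^'.
Proof. now rewrite <- (neg_imp_one x), neg_of_imp_one_imp, imp_one. Qed.

(** In the expansion by (I) the occurrence [0 ~> y] meets [z] as
    [(0 ~> y) ~> z], and this equals [(z ~> y) ~> z]. *)
Lemma imp_zero_imp_imp_any x y z : (x ~> (0 ~> y)) ~> z ≡ (x ~> (z ~> y)) ~> z.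
Proof. now rewrite (impI x _ z), <- imp_imp_self, <- impI. Qed.

Lemma imp_zero_imp_imp_one x y : (x ~> (0 ~> y)) ~> 1 ≡ (x ~> y) ~> 1.
Proof. now rewrite imp_zero_imp_imp_any, one_imp. Qed.

Lemma zero_imp_neg_imp_zero_imp x y : 0 ~> (x ~> (0 ~> y))^' ≡ 0 ~> (x ~> y)^'.
Proof. now rewrite <- !imp_one, imp_zero_imp_imp_one. Qed.

Lemma zero_imp_imp_zero x y : 0 ~> (x ~> (0 ~> y)) ≡ 0 ~> (x ~> y).
Proof.
  rewrite <- (imp_one_imp_one (x ~> (0 ~> y))), imp_zero_imp_imp_one.
  apply imp_one_imp_one.
Qed.

Lemma zero_imp_zero_imp_imp x y : 0 ~> ((0 ~> x) ~> y) ≡ 0 ~> (x ~> y).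
Proof. now rewrite <- zero_imp_imp_zero, zero_imp_imp_zero_imp, zero_imp_imp_zero. Qed.

Lemma neg_zero_imp_imp_imp x y : ((0 ~> x) ~> y)^' ~> y ≡ (0 ~> x) ~> y.
Proof.
  rewrite <- imp_one_imp_neg. change (y^') with (y ~> 0).
  rewrite <- imp_zero_imp_imp_any. change (0 ~> 0) with 1.
  now rewrite imp_one_imp_one.
Qed.

Lemma zero_imp_neg_imp_imp x y : (0 ~> (x ~> y)^') ~> y ≡ (0 ~> x) ~> y.
Proof. now rewrite <- imp_imp_self, <- neg_zero_imp_imp, neg_zero_imp_imp_imp. Qed.

(** [(x ~> y)' ~> y] has the form [b ~> a] treated in
    [zero_imp_imp_zero_imp_imp], and both sides of the implication given there
    simplify. *)
Lemma neg_imp_imp_right x y : (x ~> y)^' ~> y ≡ x ~> y.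
Proof.
  rewrite <- zero_imp_imp_zero_imp_imp.
  now rewrite zero_imp_absorb, zero_imp_neg_imp_imp, neg_imp_zero_imp_imp.
Qed.

Lemma neg_imp_imp x y : y^' ~> (x ~> y) ≡ x ~> y.
Proof. apply imp_of_neg_imp, neg_imp_imp_right. Qed.

Lemma neg_imp_imp_zero_imp x y : (x ~> y)^' ~> (0 ~> y) ≡ x ~> (0 ~> y).
Proof.
  rewrite <- zero_imp_imp_zero_imp, <- zero_imp_neg_imp_zero_imp.
  now rewrite zero_imp_neg_imp_imp, zero_imp_imp_zero_imp.
Qed.

Lemma imp_zero_imp_of_imp u v w : u ~> v ≡ w -> 0 ~> v ≡ 0 ~> w -> u ~> (0 ~> v) ≡ 0 ~> w.
Proof.
  intros h1 h2. now rewrite <- neg_imp_imp_zero_imp, h1, h2, neg_imp_zero_imp.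
Qed.

Lemma neg_imp_zero_imp_imp_of_imp x y : y^' ~> (0 ~> (x ~> y)) ≡ 0 ~> (x ~> y).
Proof. apply imp_zero_imp_of_imp; [apply neg_imp_imp | reflexivity]. Qed.

Lemma imp_zero_imp_imp_of_imp x y : x ~> (0 ~> (x ~> y)) ≡ 0 ~> (x ~> y).
Proof.
  rewrite <- (zero_imp_zero_imp_imp x y) at 1.
  apply imp_zero_imp_of_imp; [apply imp_zero_imp_imp | apply zero_imp_zero_imp_imp].
Qed.

(** * Idempotence and the swap with zero *)

Lemma zero_imp_imp_imp_imp x y : ((0 ~> x) ~> y) ~> (y ~> x) ≡ y ~> (y ~> x).
Proof.
  now rewrite <- (zero_imp_zero_imp x), imp_zero_imp_imp_any, zero_imp_imp_imp_self.
Qed.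

(** [x ~> (x ~> y)] is also [((0 ~> y) ~> x) ~> (x ~> y)], to which
    [imp_imp_imp_zero_imp] applies once [x] is read as [x' ~> 0]. The
    premise [x] in the result can be dropped, which leaves the contrapositive
    form of [x ~> y]. *)
Lemma imp_idem x y : x ~> (x ~> y) ≡ x ~> y.
Proof.
  apply neg_inj. rewrite <- zero_imp_imp_imp_imp.
  rewrite <- (dneg_equiv x) at 2. change (x^'^') with (x^' ~> 0).
  rewrite imp_imp_imp_zero_imp.
  rewrite <- (dneg_equiv x) at 1. rewrite neg_imp_imp.
  now rewrite (contrapos x y), dneg_equiv.
Qed.

(** The left side is the negation of [((y ~> z)' ~> x) ~> (y ~> z)'], and this
    becomes the expansion by (I) of the right side because [y ~> z] is
    [y ~> (y ~> z)]. *)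
Lemma imp_one_imp_common x y z : (x ~> 1) ~> (y ~> z) ≡ (x ~> y) ~> (y ~> z).
Proof.
  apply neg_inj.
  rewrite neg_of_imp_one_imp, <- imp_imp_self.
  now rewrite neg_imp_imp_expand, imp_idem.
Qed.

Lemma neg_zero_imp_imp_imp_zero_imp x y : (0 ~> (x ~> y))^' ~> y ≡ x ~> (0 ~> y).
Proof.
  rewrite neg_impI, neg_imp_zero_imp_imp_of_imp.
  rewrite <- neg_of_imp_one_imp, dneg_equiv.
  now rewrite imp_one, zero_imp_imp_zero_imp, neg_imp_imp_zero_imp.
Qed.

Lemma neg_imp_zero_imp_imp_right x y : (x ~> (0 ~> y))^' ~> y ≡ x ~> (0 ~> y).
Proof. rewrite <- neg_zero_imp_imp_imp_zero_imp. apply neg_imp_imp_right. Qed.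

(** On the left of [y], the negation [(0 ~> x) ~> 0] can be thickened to
    [(0 ~> x) ~> (0 ~> y)'], which is the negation of [(x ~> 1) ~> (0 ~> y)]. *)
Lemma neg_zero_imp_shift x y : (0 ~> x)^' ~> y ≡ x^' ~> (0 ~> y).
Proof.
  change ((0 ~> x)^') with ((0 ~> x) ~> 0).
  rewrite <- imp_zero_imp_imp_imp. change ((0 ~> y) ~> 0) with ((0 ~> y)^').
  rewrite <- (dneg_equiv ((0 ~> x) ~> (0 ~> y)^')), <- neg_of_imp_one_imp, dneg_equiv.
  now rewrite neg_imp_zero_imp_imp_right, imp_one, zero_imp_imp_zero_imp.
Qed.

(** Prefixing [(0 ~> y)'] does not change [x ~> (0 ~> y)]. Moving the [0] of this
    prefix to the right then leaves [y' ~> (0 ~> (x ~> y))], whose prefix [y']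
    can be dropped. *)
Lemma imp_zero_imp_swap x y : x ~> (0 ~> y) ≡ 0 ~> (x ~> y).
Proof.
  rewrite <- (neg_imp_imp x (0 ~> y)), neg_zero_imp_shift, zero_imp_imp_zero.
  apply neg_imp_zero_imp_imp_of_imp.
Qed.

Lemma zero_imp_imp_imp_any x y z : (0 ~> (x ~> y)) ~> z ≡ (x ~> (z ~> y)) ~> z.
Proof. now rewrite <- imp_zero_imp_swap, imp_zero_imp_imp_any. Qed.

(** Behind [0] the conclusion [y] may be replaced by [0 ~> y], after which
    [x' = x ~> 0] and [x ~> 1] have the same effect; [(x ~> 1) ~> y] negates to
    [(0 ~> x) ~> y']. *)
Lemma zero_imp_neg_neg_imp x y : 0 ~> (x^' ~> y)^' ≡ 0 ~> (x ~> y^').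
Proof.
  rewrite <- zero_imp_neg_imp_zero_imp. change (x^') with (x ~> 0) at 1.
  rewrite <- imp_one_imp_common, zero_imp_neg_imp_zero_imp.
  now rewrite neg_of_imp_one_imp, zero_imp_zero_imp_imp.
Qed.

(** * Contraction and exchange *)

Lemma imp_imp_imp_any_imp x y z : (x ~> y) ~> ((x ~> (z ~> y)) ~> z) ≡ (x ~> y) ~> z.
Proof. now rewrite <- zero_imp_imp_imp_any, imp_zero_imp_imp. Qed.

Lemma imp_imp_imp_imp_absorb x y z : ((x ~> (y ~> z)) ~> y) ~> (x ~> z) ≡ y ~> (x ~> z).
Proof. now rewrite <- zero_imp_imp_imp_any, zero_imp_imp_imp_self. Qed.

(** For [w := y ~> (x ~> z)], [(0 ~> x) ~> w] is [(w ~> x) ~> w]; idempotence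
    makes [w] end in [x ~> (x ~> z)], and the left part is absorbed. *)
Lemma zero_imp_imp_imp_contract x y z :
  (0 ~> x) ~> (y ~> (x ~> z)) ≡ x ~> (y ~> (x ~> z)).
Proof.
  rewrite <- imp_imp_self. rewrite <- (imp_idem x z) at 1.
  apply imp_imp_imp_imp_absorb.
Qed.

(** For [w := y ~> (x ~> z)], the previous lemma gives
    [(x ~> w)' ≡ (x ~> 1) ~> w' ≡ (x ~> w) ~> w']. As [w] is also
    [w' ~> (x ~> z)], the trade between [0] and the conclusion [w'] reduces
    [x ~> w] to [0 ~> (x ~> z)], which [w'] absorbs. *)
Lemma imp_imp_imp_contract x y z : x ~> (y ~> (x ~> z)) ≡ y ~> (x ~> z).
Proof.
  apply neg_inj.
  rewrite <- zero_imp_imp_imp_contract, <- imp_one_imp_neg.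
  change ((y ~> (x ~> z))^') with ((y ~> (x ~> z)) ~> 0).
  rewrite imp_one_imp_common. change ((y ~> (x ~> z)) ~> 0) with ((y ~> (x ~> z))^').
  rewrite <- (neg_imp_imp_right y (x ~> z)) at 1.
  rewrite <- imp_zero_imp_imp_any, imp_zero_imp_imp_of_imp.
  apply zero_imp_absorb.
Qed.

(** By [imp_imp_imp_any_imp] the right side is
    [(x ~> z) ~> ((x ~> (y ~> z)) ~> y)], so the premise [x ~> (y ~> z)] occurs
    twice and can be contracted. *)
Lemma imp_imp_exchange x y z : (x ~> (y ~> z)) ~> ((x ~> z) ~> y) ≡ (x ~> z) ~> y.
Proof.
  rewrite <- (imp_imp_imp_any_imp x z y) at 1.
  now rewrite imp_imp_imp_contract, imp_imp_imp_any_imp.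
Qed.

(** [imp_imp_exchange] for [x'], [y] and [0], as [x' ~> 0 ≡ x]. *)
Lemma neg_imp_neg_imp x y : (x^' ~> y^') ~> (x ~> y) ≡ x ~> y.
Proof.
  rewrite <- (dneg_equiv x) at 2 3. apply imp_imp_exchange.
Qed.

Lemma neg_imp_neg_imp_neg x y : (x ~> y)^' ~> (x^' ~> y^')^' ≡ x ~> y.
Proof.
  rewrite contrapos, !dneg_equiv, neg_imp_neg_imp.
  now rewrite zero_imp_neg_neg_imp, dneg_equiv, imp_neg_zero_imp, dneg_equiv.
Qed.

(** * Meets and joins *)

(** [(x ~> y)'] equals [((1 ~> x) ~> y)'], which (I) exhibits as a double
    negation, namely that of [(y' ~> 1) ~> (x ~> y)' ≡ (x ~> y)']. *)
Lemma tneg_of_imp x y : (x ~> y)^'^'^' = (x ~> y)^'.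
Proof.
  symmetry.
  rewrite <- (one_imp_imp_imp x y 0 : ((1 ~> x) ~> y)^' = (x ~> y)^') at 1.
  rewrite (impI 1 x y).
  change ((y^' ~> 1) ~> (x ~> y)^' ≡ (x ~> y)^').
  now rewrite neg_imp_one, zero_imp_absorb.
Qed.

Lemma neg_eq_of_equiv x y u v : x ~> y ≡ u ~> v -> (x ~> y)^' = (u ~> v)^'.
Proof.
  intros h. rewrite <- (tneg_of_imp x y), <- (tneg_of_imp u v).
  now rewrite (h : (x ~> y)^'^' = (u ~> v)^'^').
Qed.

Lemma meet_meet_join x y : meet (meet x y) (join x y) = meet x y.
Proof.
  apply neg_eq_of_equiv. unfold join, meet.
  transitivity ((x ~> y^')^' ~> (x^' ~> y^'^')^').
  - now rewrite (dneg_equiv (x^' ~> y^'^')^').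
  - apply neg_imp_neg_imp_neg.
Qed.

Lemma join_join_meet x y : join (join x y) (meet x y) = join x y.
Proof.
  change (((join x y)^' ~> (meet x y)^'^') ≡ (x^' ~> y^'^')).
  unfold join, meet.
  transitivity ((x^' ~> y^'^')^' ~> (x^'^' ~> y^'^'^')^').
  - now rewrite !dneg_equiv.
  - apply neg_imp_neg_imp_neg.
Qed.

End ImplicatorGroupoid.

Theorem theorem7p2 (A : groupoid0) (hA : is_implicator_groupoid A) :
  (forall x y : mj A, (x ∧ y) ∧ (x ∨ y) = x ∧ y) /\
  (forall x y : mj A, (x ∨ y) ∨ (x ∧ y) = x ∨ y).
Proof.
  split; intros x y.
  - exact (meet_meet_join A hA x y).
  - exact (join_join_meet A hA x y).
Qed.
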